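(* Let $\mathbf M\in[-1,1]^{m\times N}$ be the feature matrix of a dataset for which $\Omega(1/\varepsilon)$ rounds are necessary for AdaBoost to get within $\varepsilon$ of the optimal loss; that is, there are $a>0$ and $\varepsilon_0>0$ such that for all $0<\varepsilon<\varepsilon_0$ and every run of AdaBoost on $\mathbf M$, $L(\lambda^T)\le\inf_{\lambda\in\mathbb R^N}L(\lambda)+\varepsilon$ implies $T\ge a/\varepsilon$. If there are real constants $c$, $\beta$ and $A>0$ such that for any nonzero $\lambda^*\in\mathbb R^N$ and any $\varepsilon>0$ every run of AdaBoost on $\mathbf M$ achieves loss at most $L(\lambda^* )+\varepsilon$ in at most $\lceil A\,\|\lambda^*\|_1^{c}\,\varepsilon^{-\beta}\rceil$ rounds, then $\beta\ge1$.
   Context: For a feature matrix $\mathbf M$ with $m$ rows (examples) and $N$ columns (weak hypotheses), the exponential loss of $\lambda\in\mathbb R^N$ is $L(\lambda)=\frac1m\sum_{i=1}^m e^{-(\mathbf M\lambda)_i}$. AdaBoost: start with $\lambda^0=0$. In round $t=1,2,\dots$, let $D_t(i)=e^{-(\mathbf M\lambda^{t-1})_i}/\sum_{k=1}^m e^{-(\mathbf M\lambda^{t-1})_k}$, choose a column $j_t$ maximizing $\left|\sum_i D_t(i)M_{ij}\right|$ over $j$ (ties broken arbitrarily), put $r_t=\sum_i D_t(i)M_{ij_t}$ and $\alpha_t=\frac12\ln\frac{1+r_t}{1-r_t}$, and set $\lambda^t=\lambda^{t-1}+\alpha_t\mathbf e_{j_t}$, where $\mathbf e_j$ is the $j$-th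 standard basis vector. If $|r_t|=1$, the step is infinite; the loss after round $t$ is then taken to be its limiting value $0$ and the algorithm stops (all later losses are $0$). ''Achieves loss at most $x$ in at most $n$ rounds'' means $L(\lambda^t)\le x$ for some $t\le n$. *)

(* Defs.v *)
From mathcomp Require Import all_boot all_order all_algebra.
From mathcomp Require Import classical_sets reals sequences exp.

Set Implicit Arguments.
Unset Strict Implicit.
Unset Printing Implicit Defensive.

Import Order.TTheory GRing.Theory Num.Theory.

Local Open Scope ring_scope.

Section AdaBoost.
Variables (R : realType) (m N : nat) (M : 'M[R]_(m, N)).
Implicit Types (lam : 'cV[R]_N) (s : option 'cV[R]_N).

Definition l1norm lam : R := \sum_j `|lam j 0|.

Definition exp_loss lam : R := m%:R^-1 * \sum_i expR (- (M *m lam) i 0).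

Definition dist lam (i : 'I_m) : R :=
  expR (- (M *m lam) i 0) / \sum_k expR (- (M *m lam) k 0).

Definition edge lam (j : 'I_N) : R := \sum_i dist lam i * M i j.

Definition step_size (r : R) : R := 2^-1 * ln ((1 + r) / (1 - r)).

(* The state after a round is [Some lam], or [None] once an infinite step has
   been taken: the loss is then 0 and the algorithm no longer moves, so that
   every run can be indexed by all of [nat]. *)
Definition state_loss s : R := if s is Some lam then exp_loss lam else 0.

(* Any maximizer [j] is allowed, so the step is a relation. *)
Definition adaboost_step s s' : Prop :=
  if s is Some lam then
    exists2 j, (forall k, `|edge lam k| <= `|edge lam j|) &
      s' = if `|edge lam j| == 1 then None
           else Some (lam + step_size (edge lam j) *: delta_mx j 0)
  else s' = None.

Definition adaboost_run (run : nat -> option 'cV[R]_N) : Prop :=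
  run 0%N = Some 0 /\ forall t, adaboost_step (run t) (run t.+1).

End AdaBoost.

(* Main.v *)
Require Import Defs.
From mathcomp Require Import all_boot all_order all_algebra.
From mathcomp Require Import classical_sets reals sequences exp.
From mathcomp Require Import ring lra.

Set Implicit Arguments.
Unset Strict Implicit.
Unset Printing Implicit Defensive.

Import Order.TTheory GRing.Theory Num.Theory.

Local Open Scope ring_scope.

(** AdaBoost is only compared with weight vectors [lam] of controlled 1-norm,
    and the exponential loss need not attain its infimum, so the point is that
    near-minimizers never have to be large: some [lam] within [expR (- K)] of
    the infimum has 1-norm O(K).  Then, with [eps = expR (- K)], the assumed
    upper bound on the number of rounds is [eps `^ (- beta)] up to a factor
    polynomial in [K = ln (1 / eps)].  If [beta < 1], this is eventually below
    any multiple of [1 / eps], against the lower bound.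

    The O(K) bound ([small_near_minimizer]) comes from a Hoffman-type estimate
    for linear inequalities ([bounded_feasible_point]): if [M x >= b] is
    solvable, it has a solution of 1-norm at most a constant, depending only on
    [M], times the largest entry of [b] in absolute value.  Given a
    near-minimizer [mu], truncate its margins: let [b i] be the minimum of
    [(M mu) i] and [K].  Any [lam] with [M lam >= b] loses at most [expR (- K)]
    against [mu], while [b] is of size O(K), because a margin far below 0 would
    already make the loss of [mu] large.

    Since the exponent [c] may be negative, the norm of [lam] must also stay
    away from 0.  This holds because [lam = 0], where AdaBoost starts, is not
    optimal (else no round at all would be needed), and a weight vector of
    norm [y] has loss at least [1 - y] when the entries of [M] are in
    [-1, 1]. *)

(** * Small solutions of linear inequalities *)

Section SmallSolutions.
Variables (F : realFieldType) (m N : nat) (M : 'M[F]_(m, N)).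
Implicit Types (b : 'cV[F]_m) (x mu : 'cV[F]_N) (S : {set 'I_m}).

Definition feasible b x := [forall i, b i 0 <= (M *m x) i 0].

Definition tight b x := [set i | (M *m x) i 0 == b i 0].

Definition row_selector S : 'M[F]_m := diag_mx (\row_i (i \in S)%:R).

(** The transpose of a linear map that sends [b] to a solution of the equations
    [(M x) i = b i], [i] in [S], whenever these are solvable.  Linearity in [b]
    is what makes the norm of the solution proportional to that of [b]. *)
Definition equation_solver S : 'M[F]_(m, N) :=
  row_selector S *m pinvmx (M^T *m row_selector S).

Lemma mul_row_selector S (u : 'rV[F]_m) i :
  (u *m row_selector S) 0 i = u 0 i * (i \in S)%:R.
Proof. by rewrite mul_mx_diag !mxE. Qed.

Lemma equation_solverP b mu (x := (b^T *m equation_solver (tight b mu))^T) i :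
  i \in tight b mu -> (M *m x) i 0 = b i 0.
Proof.
set S := tight b mu => iS.
have def_b : b^T *m row_selector S = mu^T *m (M^T *m row_selector S).
  apply/rowP => k; rewrite mulmxA !mul_row_selector -trmx_mul.
  case: (boolP (k \in S)) => [|_]; last by rewrite !mulr0.
  by rewrite !mxE inE => /eqP <-; rewrite mxE.
have /(congr1 (fun u : 'rV_m => u 0 i)) :
    x^T *m (M^T *m row_selector S) = b^T *m row_selector S.
  rewrite /x trmxK /equation_solver [X in X *m _]mulmxA mulmxKpV // def_b.
  exact: submxMl.
rewrite mulmxA !mul_row_selector iS !mulr1 -trmx_mul => xi.
by rewrite !mxE in xi *.
Qed.

Lemma l1_mulmx_le b (B : F) (G : 'M[F]_(m, N)) :
  (forall i, `|b i 0| <= B) ->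
  \sum_j `|(b^T *m G)^T j 0| <= B * \sum_j \sum_i `|G i j|.
Proof.
move=> bB; rewrite mulr_sumr; apply: ler_sum => j _.
rewrite !mxE mulr_sumr; apply: le_trans (ler_norm_sum _ _ _) _.
by apply: ler_sum => i _; rewrite mxE normrM ler_wpM2r.
Qed.

(** Moving from a feasible point towards an infeasible one that satisfies the
    tight constraints with equality, the first constraint that blocks the way
    becomes tight and all tight constraints remain so. *)
Lemma tighten b mu x :
  feasible b mu -> {in tight b mu, forall i, (M *m x) i 0 = b i 0} ->
  ~~ feasible b x ->
  exists2 nu, feasible b nu & tight b mu \proper tight b nu.
Proof.
move=> /forallP mu_ok x_eq /forallPn[i0]; rewrite -ltNge => i0V.
pose p i := (M *m mu) i 0; pose q i := (M *m x) i 0.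
pose theta i := (p i - b i 0) / (p i - q i).
case: (@arg_minP _ _ _ i0 (fun i => q i < b i 0) theta i0V) => i iV theta_min.
have pb k : b k 0 <= p k by exact: mu_ok.
have gap k : q k < b k 0 -> 0 < p k - q k by have := pb k; lra.
have th0 : 0 <= theta i by rewrite divr_ge0 ?(ltW (gap _ iV)) ?subr_ge0.
have th1 : theta i <= 1 by rewrite ler_pdivrMr ?gap // mul1r; lra.
pose nu := mu + theta i *: (x - mu).
have nuE k : (M *m nu) k 0 = p k + theta i * (q k - p k).
  by rewrite /nu mulmxDr -scalemxAr mulmxBr /p /q !mxE.
exists nu.
  apply/forallP => k; rewrite nuE.
  have [kV|kV] := ltP (q k) (b k 0).
    have := theta_min k kV; rewrite {2}/theta ler_pdivlMr ?gap //; lra.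
  have := pb k; nra.
apply/properP; split.
  apply/fintype.subsetP => k; rewrite !inE nuE => k_tight.
  have := x_eq k; rewrite inE k_tight => /(_ isT); rewrite -/(q k) => ->.
  by rewrite -/(p k) in k_tight *; rewrite (eqP k_tight) subrr mulr0 addr0.
exists i.
  have -> : (i \in tight b nu) = (p i + theta i * (q i - p i) == b i 0).
    by rewrite inE nuE.
  by apply/eqP; rewrite /theta; field; rewrite gt_eqF ?gap.
by apply/negP => /x_eq; rewrite -/(q i) => qb; move: iV; rewrite qb ltxx.
Qed.

(** A feasible point with as many tight constraints as possible can be replaced
    by the canonical solution of its tight equations, and only finitely many
    linear solution maps arise in this way. *)
Lemma bounded_feasible_point :
  exists2 C : F, 0 < C & forall b mu (B : F), feasible b mu ->
    (forall i, `|b i 0| <= B) -> 0 <= B ->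
    exists2 x, feasible b x & \sum_j `|x j 0| <= C * B.
Proof.
pose nrm S := \sum_j \sum_i `|equation_solver S i j|.
have nrm_ge0 S : 0 <= nrm S by apply: sumr_ge0 => j _; apply: sumr_ge0.
exists (1 + \sum_S nrm S); first by rewrite ltr_pwDl // sumr_ge0.
move=> b mu B; have [n] := ubnP #|~: tight b mu|.
elim: n mu => // n IHn mu lt_n mu_ok bB B0.
set x := (b^T *m equation_solver (tight b mu))^T.
have [x_ok|x_bad] := boolP (feasible b x).
  exists x => //; apply: le_trans (l1_mulmx_le _ bB) _.
  rewrite mulrC ler_wpM2r // -/(nrm _) (bigD1 (tight b mu)) //=.
  by rewrite [leRHS]addrCA lerDl addr_ge0 // sumr_ge0.
have [nu nu_ok lt_nu] := tighten mu_ok (@equation_solverP b mu) x_bad.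
apply: (IHn nu) => //; rewrite -ltnS; apply: leq_trans lt_n.
by rewrite ltnS proper_card // properC.
Qed.

End SmallSolutions.

(** * Near-minimizers of the exponential loss *)

Section ExpLoss.
Variables (R : realType) (m N : nat) (M : 'M[R]_(m, N)).
Hypothesis m_gt0 : (0 < m)%N.
Implicit Types lam mu : 'cV[R]_N.

Let m_pos : 0 < m%:R :> R. Proof. by rewrite ltr0n. Qed.

Lemma exp_loss_ge0 lam : 0 <= exp_loss M lam.
Proof.
by rewrite mulr_ge0 ?invr_ge0 ?ler0n // sumr_ge0 // => i _; apply: expR_ge0.
Qed.

Lemma exp_loss0 : exp_loss M 0 = 1.
Proof.
rewrite /exp_loss (eq_bigr (fun=> 1)) => [|i _].
  by rewrite sumr_const card_ord mulVf // gt_eqF.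
by rewrite mulmx0 mxE oppr0 expR0.
Qed.

Lemma has_inf_exp_loss : has_inf (range (exp_loss M)).
Proof.
split; first by exists (exp_loss M 0); exists 0.
by exists 0 => _ [lam _ <-]; apply: exp_loss_ge0.
Qed.

Lemma exp_loss_ge1B lam :
  (forall i j, -1 <= M i j <= 1) -> 1 - l1norm lam <= exp_loss M lam.
Proof.
move=> M_bound; rewrite /exp_loss mulrC ler_pdivlMr //.
have -> : (1 - l1norm lam) * m%:R = \sum_(i < m) (1 - l1norm lam).
  by rewrite sumr_const card_ord mulr_natr.
apply: ler_sum => i _; apply: le_trans (expR_ge1Dx _).
rewrite lerD2l lerN2 mxE; apply: ler_sum => j _.
apply: le_trans (ler_norm _) _; rewrite normrM ler_piMl //.
by rewrite ler_norml M_bound.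
Qed.

(** Truncating the margins of [mu] at [K] costs at most [expR (- K)] per
    example.  No margin of [mu] is below [- m], since a loss of at most 1
    bounds each of the [m] exponentials by [m]. *)
Lemma small_near_minimizer :
  exists2 C : R, 0 < C & forall (K : R) mu, 0 <= K -> exp_loss M mu <= 1 ->
    exists2 lam, exp_loss M lam <= exp_loss M mu + expR (- K) &
      l1norm lam <= C * (K + m%:R).
Proof.
have [C C_gt0 small] := bounded_feasible_point M.
exists C => // K mu K0 mu1.
pose b : 'cV[R]_m := \col_i Num.min ((M *m mu) i 0) K.
have margin i : - m%:R <= (M *m mu) i 0.
  have : expR (- (M *m mu) i 0) <= m%:R.
    move: mu1; rewrite /exp_loss mulrC ler_pdivrMr // mul1r; apply: le_trans.
    by rewrite (bigD1 i) //= lerDl sumr_ge0 // => k _; apply: expR_ge0.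
  by move/(le_trans (expR_ge1Dx _)); lra.
have [|i||lam /forallP lam_ok lam_small] := small b mu (K + m%:R).
- by apply/forallP => i; rewrite mxE ge_min lexx.
- rewrite mxE ler_norml le_min ge_min; have := margin i.
  have m0 := m_pos => h; apply/andP.
  by split; [apply/andP; split|apply/orP; right]; lra.
- by rewrite addr_ge0.
exists lam => //; rewrite /exp_loss -lerBlDl -mulrBr -sumrB mulrC ler_pdivrMr //.
have -> : expR (- K) * m%:R = \sum_(i < m) expR (- K).
  by rewrite sumr_const card_ord mulr_natr.
apply: ler_sum => i _; have := lam_ok i; rewrite mxE ge_min lerBlDl => /orP[] h.
  by apply: ler_wpDr; rewrite ?expR_ge0 // ler_expR lerN2.
by apply: ler_wpDl; rewrite ?expR_ge0 // ler_expR lerN2.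
Qed.

End ExpLoss.

(** * Existence of runs *)

(** The hypotheses only speak about all runs of AdaBoost, so they would be
    void if there were none. *)
Lemma adaboost_run_exists (R : realType) (m N : nat) (M : 'M[R]_(m, N)) :
  (0 < N)%N -> exists run, adaboost_run M run.
Proof.
move=> N_gt0; pose j0 := Ordinal N_gt0.
pose best lam := [arg max_(j > j0) `|edge M lam j|]%O.
pose next s := if s is Some lam then
    if `|edge M lam (best lam)| == 1 then None
    else Some (lam + step_size (edge M lam (best lam)) *: delta_mx (best lam) 0)
  else None.
exists (fun t => iter t next (Some 0)); split=> // t /=.
case: (iter t next (Some 0)) => [lam|] //=.
exists (best lam) => // k.
by rewrite /best; case: Order.TotalTheory.arg_maxP => // j _; apply.
Qed.

(** * Exponentials against powers *)

Lemma powR_expRN_bounded (R : realType) (kappa delta c : R) :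
  0 < kappa -> 0 < delta ->
  exists2 B : R, 0 < B &
    forall y, delta <= y -> y `^ c * expR (- (kappa * y)) <= B.
Proof.
move=> k0 d0; have powE y : delta <= y -> y `^ c = expR (c * ln y).
  by move=> dy; rewrite /powR gt_eqF // (lt_le_trans d0).
have [c0|c0] := leP c 0.
  exists (expR (c * ln delta)) => [|y dy]; first exact: expR_gt0.
  have y0 := lt_le_trans d0 dy.
  rewrite powE // -expRD ler_expR.
  have : ln delta <= ln y by rewrite ler_ln ?posrE.
  nra.
(* For x = kappa / c * y, the inequality ln x < x bounds c * ln y by kappa * y
   up to a constant. *)
exists (expR (- (c * ln (kappa / c)))) => [|y dy]; first exact: expR_gt0.
have y0 := lt_le_trans d0 dy.
rewrite powE // -expRD ler_expR.
have kc0 : 0 < kappa / c by apply: divr_gt0.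
have h := ln_sublinear (mulr_gt0 kc0 y0).
have lnE : ln (kappa / c * y) = ln (kappa / c) + ln y by exact: lnM.
have : c * (ln (kappa / c) + ln y) <= c * (kappa / c * y).
  by rewrite -lnE ler_wpM2l ?ltW.
have -> : c * (kappa / c * y) = kappa * y by field; rewrite gt_eqF.
lra.
Qed.

Lemma expRN_le_inv (R : realType) (x : R) : 0 < x -> expR (- x) <= x^-1.
Proof.
move=> x0; rewrite expRN lef_pV2 ?posrE ?expR_gt0 //.
by have := expR_ge1Dx x; lra.
Qed.

(** * The lower bound on the exponent *)

Theorem corollary30 (R : realType) (m N : nat) (M : 'M[R]_(m, N))
    (m_gt0 : (0 < m)%N) (N_gt0 : (0 < N)%N)
    (M_bound : forall i j, -1 <= M i j <= 1)
    (lower : exists a eps0 : R, [/\ 0 < a, 0 < eps0 &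
      forall eps : R, 0 < eps < eps0 ->
      forall run, adaboost_run M run ->
      forall T : nat,
        state_loss M (run T) <= inf (range (exp_loss M)) + eps ->
        a / eps <= T%:R])
    (c beta A : R) (A_gt0 : 0 < A)
    (upper : forall lam : 'cV[R]_N, lam != 0 ->
      forall eps : R, 0 < eps ->
      forall run, adaboost_run M run ->
      exists2 t : nat,
        t%:Z <= Num.ceil (A * (l1norm lam `^ c) * (eps `^ (- beta))) &
        state_loss M (run t) <= exp_loss M lam + eps) :
  1 <= beta.
Proof.
case: lower => a [eps0] [a0 e0 lower_bound].
have [run run_ok] := adaboost_run_exists M N_gt0.
set L := inf _ in lower_bound.
rewrite leNgt; apply/negP => beta_lt1.
(* The zero vector is not optimal: AdaBoost would need no round at all. *)
have L_lt1 : L + eps0 / 2 < 1.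
  rewrite ltNge; apply/negP => h.
  have eps_ok : 0 < eps0 / 2 < eps0 by apply/andP; split; lra.
  have := lower_bound _ eps_ok run run_ok 0%N.
  rewrite run_ok.1 /= exp_loss0 // => /(_ h); rewrite leNgt divr_gt0 //; lra.
have [C C0 small] := small_near_minimizer M m_gt0.
pose gamma := 1 - beta; have g0 : 0 < gamma by rewrite /gamma; lra.
(* Half of the decay expR (- gamma * K) absorbs the power of the norm, which is
   at most C * (K + m); the other half remains. *)
pose kappa := gamma / (2 * C).
have k0 : 0 < kappa by rewrite divr_gt0 // mulr_gt0.
have d0 : 0 < eps0 / 6 by lra.
have [B B0 decay] := powR_expRN_bounded c k0 d0.
pose Q := A * B * expR (gamma * m%:R / 2).
have Q0 : 0 < Q by rewrite !mulr_gt0 ?expR_gt0.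
pose X := (2 * Q / gamma + 1) * (3 / a).
have Qg0 : 0 < 2 * Q / gamma by apply: divr_gt0 => //; apply: mulr_gt0.
have X0 : 0 < X by apply: mulr_gt0; [apply: addr_gt0 | apply: divr_gt0].
(* The first summand keeps eps below a fraction of eps0; since K > X, the lower
   bound a / (3 * eps) on the number of rounds contradicts the upper bound. *)
pose K := 6 / eps0 + X.
have K0 : 0 < K by apply: addr_gt0 => //; apply: divr_gt0.
pose eps := expR (- K); have eps_gt0 : 0 < eps by exact: expR_gt0.
have eps_le : eps <= K^-1 by exact: expRN_le_inv.
have eps_small : eps <= eps0 / 6.
  apply: le_trans eps_le _; rewrite -[leRHS]invf_div lef_pV2 ?posrE ?divr_gt0 //.
  by rewrite /K lerDl ltW.
have [_ [mu _ <-] mu_near] := inf_adherent eps_gt0 (has_inf_exp_loss M).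
rewrite -/L in mu_near.
have mu_le1 : exp_loss M mu <= 1 by lra.
have [lam lam_near lam_small] := small K mu (ltW K0) mu_le1.
rewrite -/eps in lam_near; set y := l1norm lam in lam_small.
have y_ge : eps0 / 6 <= y.
  by have := exp_loss_ge1B m_gt0 lam M_bound; rewrite -/y; lra.
have lam0 : lam != 0.
  apply/eqP => lam0; move: y_ge; rewrite /y lam0 /l1norm big1 => [|j _]; first lra.
  by rewrite mxE normr0.
have [t t_le t_loss] := upper lam lam0 eps eps_gt0 run run_ok.
have eps3 : 0 < 3 * eps < eps0 by apply/andP; split; lra.
have t_ge : a / (3 * eps) <= t%:R by apply: (lower_bound _ eps3 run run_ok t); lra.
set z := A * _ * _ in t_le.
have t_lt : t%:R < z + 1.
  have := ceilB1_lt z; rewrite rmorphB /= ltrBlDr; apply: le_lt_trans.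
  by move: t_le; rewrite -(ler_int R).
have eps_z : eps * z <= Q * expR (- (gamma * K / 2)).
  have -> : eps * z = A * y `^ c * expR (- (gamma * K)).
    rewrite /z -/y {2}/eps /powR [eps == 0]gt_eqF // expRK mulrCA -expRD.
    by congr (_ * expR _); rewrite /gamma; ring.
  have expo : expR (- (gamma * K)) <=
      expR (- (kappa * y)) * expR (gamma * m%:R / 2) * expR (- (gamma * K / 2)).
    rewrite -!expRD ler_expR.
    have : kappa * y <= kappa * (C * (K + m%:R)) by rewrite ler_wpM2l // ltW.
    have -> : kappa * (C * (K + m%:R)) = gamma * K / 2 + gamma * m%:R / 2.
      by rewrite /kappa; field; rewrite gt_eqF.
    lra.
  have Ay0 : 0 <= A * y `^ c by rewrite mulr_ge0 ?powR_ge0 // ltW.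
  apply: le_trans (ler_wpM2l Ay0 expo) _.
  rewrite !mulrA ler_wpM2r ?expR_ge0 // ler_wpM2r ?expR_ge0 //.
  by rewrite -mulrA ler_wpM2l ?decay // ltW.
have half_decay : Q * expR (- (gamma * K / 2)) <= 2 * Q / gamma * K^-1.
  have -> : 2 * Q / gamma * K^-1 = Q * (gamma * K / 2)^-1.
    by field; rewrite !gt_eqF.
  by rewrite ler_wpM2l ?(ltW Q0) // expRN_le_inv // divr_gt0 ?mulr_gt0.
have a_lt : a / 3 < (2 * Q / gamma + 1) * K^-1.
  have : eps * (a / (3 * eps)) < eps * (z + 1).
    by rewrite ltr_pM2l // (le_lt_trans t_ge).
  have -> : eps * (a / (3 * eps)) = a / 3 by field; rewrite gt_eqF.
  by rewrite mulrDl mul1r mulrDr mulr1; lra.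
have : K < X.
  by move: a_lt; rewrite ltr_pdivlMr // mulrC -ltr_pdivlMr ?divr_gt0 // invf_div.
by rewrite /K ltNge lerDr divr_ge0 // ltW.
Qed.
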